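(* Let $Z, Z', V$ be Banach spaces, let $f: Z\times V\to Z'$ be a function, let $F: Z\rightrightarrows Z'$ be a set-valued map, and for each $(z,v)\in Z\times V$ let $H(z,v): Z\to Z'$. Define $$f_H(z,\zeta,v)=f(\zeta,v)+H(\zeta,v)(z-\zeta).$$ Let $\bar z\in Z$ and $\kappa,\gamma_z,\gamma_v>0$ satisfy: (a) $\bar z$ is a solution of $f(\cdot,0)+F\ni 0$; (b) $f_H(\cdot,\zeta,v)$ is Lipschitz continuous uniformly in $(\zeta,v)$ at $(\bar z,\bar z,0)$; (c) $f_H(z,\cdot,v)$ is Lipschitz continuous with constant $\gamma_z$ uniformly in $(z,v)$ at $(\bar z,\bar z,0)$; (d) $f_H(z,\zeta,\cdot)$ is Lipschitz continuous with constant $\gamma_v$ uniformly in $(z,\zeta)$ at $(\bar z,\bar z,0)$; (e) $f_H(\cdot,\bar z,0)+F$ is strongly regular with constant $\kappa$ at $\bar z$ for $0$; and $\kappa\gamma_z<1$. Then for all $(z_k,v_k)$ sufficiently close to $(\bar z,0)$ the iteration $$f(z_k,v_k)+H(z_k,v_k)(z_{k+1}-z_k)+F(z_{k+1})\ni 0$$ is (locally) unique, i.e. there is a neighbourhood of $\bar z$ which contains exactly one solution $z_{k+1}$, and this solution satisfies $$\|z_{k+1}-\bar z\|\le \kappa\gamma_z\|z_k-\bar z\|+\gamma\|v_k\|$$ for some constant $\gamma>0$ independent of $(z_k,v_k)$. That is, the iteration is locally input-to-state stable around $\bar z$.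
   Context: A set-valued map $G: X\rightrightarrows Y$ assigns to each $x\in X$ a subset $G(x)\subset Y$; $\operatorname{graph}G=\{(x,y): y\in G(x)\}$ and $G^{-1}(y)=\{x: y\in G(x)\}$. Strong regularity: for $(\bar x,\bar y)\in\operatorname{graph}G$, $G$ is strongly regular at $\bar x$ for $\bar y$ with constant $\kappa$ if $G^{-1}$ has a Lipschitz continuous single-valued localization at $\bar y$ for $\bar x$ with constant $\kappa$, i.e. there are neighbourhoods $U$ of $\bar x$ and $W$ of $\bar y$ and a function $s:W\to X$, Lipschitz continuous on $W$ with constant $\kappa$, such that $G^{-1}(y)\cap U=\{s(y)\}$ for all $y\in W$. Uniform Lipschitz continuity: a function $\phi(x,y)$ is Lipschitz continuous with respect to $x$ with constant $\gamma$ uniformly in $y$ at $(\bar x,\bar y)$ if $\phi(\cdot,y)$ is Lipschitz continuous in a (common) neighbourhood of $\bar x$ with constant $\gamma<\infty$ for all $y$ in a neighbourhood of $\bar y$; if no constant is mentioned, some finite constant exists. The evaluation point lists the arguments in the order $(z,\zeta,v)$. Local input-to-state stability: the system $z_{k+1}=\Phi(z_k,v_k)$, $k\in\mathbb N$, with disturbance sequence $\mathbf v=(v_0,v_1,\ldots)\subset V$ and $\|\mathbf v\|_\infty=\sup_k\|v_k\|<\infty$, is locally input-to-state stable around $\bar z$ if there exist $\epsilon,\delta>0$, $\beta\in\mathcal{KL}$, $\gamma\in\mathcal K_\infty$ such that any sequence $\{z_k\}$ generated under a disturbance with $\|\mathbf v\|_\infty<\delta$ satisfies $\|z_k-\bar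 z\|\le\beta(\|z_0-\bar z\|,k)+\gamma(\|\mathbf v\|_\infty)$ for all $k\in\mathbb N$, provided $\|z_0-\bar z\|<\epsilon$. For the iteration above, $\Phi(z_k,v_k)$ is the locally unique solution $z_{k+1}$. Here $\mathcal K_\infty$ and $\mathcal{KL}$ are the usual comparison function classes.
   Formalization: Each H(z,v): Z→Z' is taken to be a linear operator; for arbitrary maps uniqueness fails, e.g. on R with F={0}, f_H(z,ζ,v)=z−clip(z,[−|ζ|/2,|ζ|/2]), where (a)–(e) hold with κ=1, γ_z=1/2 but every |z|≤|ζ|/2 is a solution. *)

(* Defs.v *)
From HB Require Import structures.
From mathcomp Require Export all_boot all_order all_algebra.
From mathcomp Require Export all_classical all_reals all_analysis.
Set Implicit Arguments.
Unset Strict Implicit.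
Unset Printing Implicit Defensive.
Export Order.TTheory GRing.Theory Num.Theory numFieldNormedType.Exports.
Global Open Scope classical_set_scope.
Global Open Scope ring_scope.

Section SetValued.
Context {R : realType} {X Y : normedModType R}.

Definition add_setmap (g : X -> Y) (F : X -> set Y) : X -> set Y :=
  fun x => [set g x + y | y in F x].

Definition strongly_regular (G : X -> set Y) (xbar : X) (ybar : Y)
    (kappa : R) : Prop :=
  G xbar ybar /\
  exists (U : set X) (W : set Y) (s : Y -> X),
    [/\ nbhs xbar U, nbhs ybar W, kappa.-lipschitz_W s &
        forall y, W y -> [set x | G x y] `&` U = [set s y]].

End SetValued.

(* The neighbourhood [A] of [xbar] is common to all [y] near [ybar]. *)
Definition uniformly_lipschitz {R : realType} {X E : normedModType R}
    {P : topologicalType} (phi : X -> P -> E) (xbar : X) (ybar : P)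
    (gamma : R) : Prop :=
  exists2 A : set X, nbhs xbar A &
    \forall y \near ybar, gamma.-lipschitz_A (phi ^~ y).

(* Comparison functions are maps on [0, +oo[; their values at negative
   arguments are irrelevant. *)
Section Comparison.
Context {R : realType}.

Definition class_K (g : R -> R) : Prop :=
  [/\ {within `[0, +oo[, continuous g}, g 0 = 0 &
      forall r s : R, 0 <= r -> r < s -> g r < g s].

Definition class_Koo (g : R -> R) : Prop :=
  class_K g /\ g r @[r --> +oo] --> +oo.

(* Strict decrease can only be asked for [r > 0], as [beta 0 t = 0]. *)
Definition class_KL (beta : R -> R -> R) : Prop :=
  [/\ {within [set p : R * R | 0 <= p.1 /\ 0 <= p.2],
        continuous (fun p : R * R => beta p.1 p.2)},
      forall t : R, 0 <= t -> class_K (beta ^~ t),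
      forall r t u : R, 0 < r -> 0 <= t -> t < u -> beta r u < beta r t &
      forall r : R, 0 <= r -> beta r t @[t --> +oo] --> 0].

End Comparison.

(* Meaningful only for bounded [v], since [sup] is [0] on unbounded sets. *)
Definition supnorm {R : realType} {V : normedModType R} (v : nat -> V) : R :=
  sup (range (fun k => `|v k|)).

Definition locally_ISS {R : realType} {Z V : normedModType R}
    (Phi : Z -> V -> Z) (zbar : Z) : Prop :=
  exists (eps delta : R) (beta : R -> R -> R) (gamma : R -> R),
    [/\ 0 < eps, 0 < delta, class_KL beta, class_Koo gamma &
      forall (z : nat -> Z) (v : nat -> V),
        (forall k, z k.+1 = Phi (z k) (v k)) ->
        has_ubound (range (fun k => `|v k|)) -> supnorm v < delta ->
        `|z 0%N - zbar| < eps ->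
        forall k, `|z k - zbar| <=
          beta `|z 0%N - zbar| k%:R + gamma (supnorm v)].

Section NewtonType.
Context {R : realType} {Z Z' V : normedModType R}.
Variables (f : Z -> V -> Z') (H : Z -> V -> {linear Z -> Z'}).

Definition fH (z zeta : Z) (v : V) : Z' := f zeta v + H zeta v (z - zeta).

Definition next_iterates (F : Z -> set Z') (z : Z) (v : V) : set Z :=
  [set z' | add_setmap (fun x => f z v + H z v (x - z)) F z' 0].

End NewtonType.

(* Main.v *)
From HB Require Import structures.
Require Import Defs.
From mathcomp Require Import ring lra.
Set Implicit Arguments.
Unset Strict Implicit.
Unset Printing Implicit Defensive.

(** The inclusion solved by one step from [(z, v)] is a perturbation of the
    inclusion linearized at the reference point: with
    [h x = fH x z v - fH x zbar 0] it reads [- h x \in G x], where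
    [G = fH _ zbar 0 + F] is strongly regular. If [s] is the localization of
    the inverse of [G], its solutions near [zbar] are the fixed points of
    [x |-> s (- h x)].

    Two bounds on [h] are needed. Going from [(zbar, 0)] to [(z, v)] through
    [(zbar, v)], so that each leg changes only one argument, the Lipschitz
    conditions give [`|h x| <= eta := gamma_z * `|z - zbar| + gamma_v * `|v|] for
    all [x] in a fixed ball around [zbar] ([fH_perturbation_bound]). Moreover
    [h] is affine, with linear part [D = H z v - H zbar 0]; being bounded by
    [eta] on a ball of radius [r], it is Lipschitz with constant [2 * eta / r]
    ([linear_bound_from_ball]), which tends to [0] as [(z, v)] tends to
    [(zbar, 0)]. So the Lipschitz conditions on [fH] imply that [H] is
    continuous at [(zbar, 0)] for the operator norm, and this is what makes the
    perturbation [h] small in the Lipschitz sense.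

    For [(z, v)] close to [(zbar, 0)] the map [x |-> s (- h x)] is therefore a
    contraction of the closed ball of radius [r], and Banach's theorem gives the
    unique solution [z'] in that ball ([strong_regularity_perturbed]). As
    [zbar = s 0], one gets [`|z' - zbar| <= kappa * `|h z'| <= kappa * eta],
    which is the announced estimate.

    Since [q = kappa * gamma_z < 1], iterating this estimate yields
    [`|z_k - zbar| <= q ^ k * `|z_0 - zbar| + gamma / (1 - q) * `|v|_oo], where
    [gamma = kappa * gamma_v], as long as the iterates stay in the region where
    the estimate is valid, and a small disturbance cannot drive them out of it
    ([locally_ISS_of_contraction]). *)

(** * Perturbation of strongly regular maps *)

(** By homogeneity: [r / `|u| *: u] has norm [r]. *)
Lemma linear_bound_from_ball (R : realType) (X Y : normedModType R)
    (D : {linear X -> Y}) (r M : R) :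
  0 < r -> (forall w, `|w| <= r -> `|D w| <= M) ->
  forall u, `|D u| <= M / r * `|u|.
Proof.
move=> r0 DM u; have [->|u0] := eqVneq u 0.
  by rewrite linear0 !normr0 mulr0.
have nu0 : 0 < `|u| by rewrite normr_gt0.
have := DM ((r / `|u|) *: u).
rewrite linearZ !normrZ normfV normr_id (gtr0_norm r0) divfK ?gt_eqF//.
move=> /(_ (lexx r)).
by rewrite -ler_pdivlMl ?divr_gt0// invf_div [_ * M]mulrC mulrA mulrAC.
Qed.

(** The points [x] of the ball with [G x (- h x)] are exactly the fixed points
    of [x |-> s (- h x)], because the ball lies in [U] and [- h x] in [W]. The
    condition [kappa * eta <= r] makes the ball invariant and [kappa * l < 1]
    makes the map contract, so Banach's fixed point theorem applies. *)
Lemma strong_regularity_perturbed (R : realType) (X : completeNormedModType R)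
    (Y : normedModType R) (G : X -> set Y) (xbar : X) (U : set X) (W : set Y)
    (s : Y -> X) (h : X -> Y) (kappa l r eta : R) :
  G xbar 0 -> kappa.-lipschitz_W s ->
  (forall y, W y -> [set x | G x y] `&` U = [set s y]) ->
  0 <= kappa -> 0 <= l -> 0 < r ->
  (forall x, `|x - xbar| <= r -> U x) -> (forall y, `|y| <= eta -> W y) ->
  (forall x, `|x - xbar| <= r -> `|h x| <= eta) ->
  l.-lipschitz_(closed_ball xbar r) h ->
  kappa * l < 1 -> kappa * eta <= r ->
  exists2 x' : X,
    [set x | G x (- h x)] `&` closed_ball xbar r = [set x'] &
    `|x' - xbar| <= kappa * eta.
Proof.
move=> G0 slip sE k0 l0 r0 BU etaW h_eta hlip kl1 keta.
have BE x : closed_ball xbar r x <-> `|x - xbar| <= r.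
  by rewrite closed_ballE// /closed_ball_ /= distrC.
have cB : closed_ball xbar r xbar by apply/BE; rewrite subrr normr0 ltW.
have eta0 : 0 <= eta by apply: le_trans (h_eta xbar _); [|exact/BE].
have W0 : W 0 by apply: etaW; rewrite normr0.
have s0 : s 0 = xbar.
  have : ([set x | G x 0] `&` U) xbar by split => //; apply/BU/BE.
  by rewrite (sE _ W0) => <-.
have WNh x : closed_ball xbar r x -> W (- h x).
  by move=> /BE xr; apply: etaW; rewrite normrN; exact: h_eta.
have GE x : closed_ball xbar r x -> G x (- h x) <-> x = s (- h x).
  move=> Bx; have sx := sE _ (WNh _ Bx); split => [Gx|xE].
    have : ([set x0 | G x0 (- h x)] `&` U) x by split => //; apply/BU/BE.
    by rewrite sx.
  by have : [set s (- h x)] x by []; rewrite -sx => -[].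
have s_near x : closed_ball xbar r x -> `|s (- h x) - xbar| <= kappa * eta.
  move=> Bx; rewrite -[in X in `|X|]s0.
  have := slip (- h x, 0) (conj (WNh _ Bx) W0).
  move/le_trans; apply; rewrite /= subr0 normrN ler_wpM2l//.
  by apply: h_eta; apply/BE.
(* Banach's theorem is stated for bundled self-maps of the closed set. *)
pose T x := s (- h x).
have Tfun : set_fun (closed_ball xbar r) (closed_ball xbar r) T.
  by move=> x Bx; apply/BE; apply: le_trans (s_near _ Bx) keta.
pose Tm : {fun closed_ball xbar r >-> closed_ball xbar r} := HB.pack T
  (isFun.Build _ _ _ _ T Tfun).
have Tc : is_contraction Tm.
  exists (NngNum (mulr_ge0 k0 l0)); split => //= -[x y] [/= Bx By].
  apply: (le_trans (slip (- h x, - h y) (conj (WNh _ Bx) (WNh _ By)))) => /=.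
  rewrite -mulrA ler_wpM2l// -opprD normrN.
  exact: (hlip (x, y) (conj Bx By)).
have [p Bp pE] := banach_fixed_point Tc (@closed_ball_closed _ _ _ _)
  (ex_intro _ xbar cB).
exists p; last by rewrite pE; exact: s_near.
apply/seteqP; split => x /=; last by move=> ->; split => //; exact/(GE _ Bp).
move=> [Gx Bx]; apply: (contraction_fixpoint_unique Tc) => //.
exact/(GE _ Bx).
Qed.

(** * Comparison functions and input-to-state stability *)

(** This is [r * q ^ t] for real [t]; at a natural number [k] it is
    [r * q ^+ k], the decay of an iterated contraction. *)
Lemma class_KL_exp (R : realType) (q : R) : 0 < q -> q < 1 ->
  class_KL (fun r t : R => r * expR (t * ln q)).
Proof.
move=> q0 q1; have lnq : ln q < 0 by rewrite ln_lt0// q0.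
split=> [|t _|r t u r0 _ tu|r _].
- apply: continuous_subspaceT => p; apply: cvgM; first exact: cvg_fst.
  apply: (@cvg_comp _ _ _ (fun p : R * R => p.2 * ln q) expR _
    (nbhs (p.2 * ln q))).
    by apply: cvgM; [exact: cvg_snd|exact: cvg_cst].
  exact: continuous_expR.
- split; last by move=> r s _ rs; rewrite ltr_pM2r// expR_gt0.
    apply: continuous_subspaceT => r; apply: cvgM; [exact: cvg_id|exact: cvg_cst].
  by rewrite mul0r.
- by rewrite ltr_pM2l// ltr_expR ltr_nM2r.
- rewrite -[X in _ --> X](mulr0 r); apply: cvgM; first exact: cvg_cst.
  have tlnq : t * - ln q @[t --> +oo] --> +oo.
    by apply: gt0_cvgMly; [rewrite oppr_gt0|exact: cvg_id].
  rewrite (_ : (fun t => _) = (fun x => expR (- x)) \o (fun t => t * - ln q)).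
    exact: cvg_comp tlnq (@cvgr_expR R).
  by apply/funext => t /=; rewrite mulrN opprK.
Qed.

Lemma class_Koo_linear (R : realType) (c : R) : 0 < c -> class_Koo ( *%R c).
Proof.
move=> c0; split; first split.
- apply: continuous_subspaceT => r; apply: cvgM; [exact: cvg_cst|exact: cvg_id].
- by rewrite mulr0.
- by move=> r s _ rs; rewrite ltr_pM2l.
- by apply: gt0_cvgMry => //; exact: cvg_id.
Qed.

Lemma le_supnorm (R : realType) (V : normedModType R) (v : nat -> V) (k : nat) :
  has_ubound (range (fun k => `|v k|)) -> `|v k| <= supnorm v.
Proof. by move=> bv; apply: ub_le_sup => //; exists k. Qed.

(** The bound is only available while [`|z k - zbar| < rho]. The disturbance is
    bounded by [(1 - q) * rho / gamma] so that
    [q * rho + gamma * `|v k| < rho], which keeps all iterates in that region;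
    the gain [gamma / (1 - q)] is the sum of the geometric series
    [gamma * q ^ k]. *)
Lemma locally_ISS_of_contraction (R : realType) (Z V : normedModType R)
    (Phi : Z -> V -> Z) (zbar : Z) (q gamma : R) :
  0 < q -> q < 1 -> 0 < gamma ->
  (\forall p \near (zbar, 0 : V),
     `|Phi p.1 p.2 - zbar| <= q * `|p.1 - zbar| + gamma * `|p.2|) ->
  locally_ISS Phi zbar.
Proof.
move=> q0 q1 g0 /nbhs_ballP[rho /= rho0 Phi_le].
have q'0 : 0 < 1 - q by rewrite subr_gt0.
exists rho, (Num.min rho ((1 - q) * rho / gamma)).
exists (fun r t : R => r * expR (t * ln q)), ( *%R (gamma / (1 - q))).
split => //.
- by rewrite lt_min rho0 divr_gt0// mulr_gt0.
- exact: class_KL_exp.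
- by apply: class_Koo_linear; rewrite divr_gt0.
move=> z v zE bv; rewrite lt_min => /andP[vrho vgamma] z0 k.
rewrite ltr_pdivlMr// mulrC in vgamma.
have vs j : `|v j| <= supnorm v by exact: le_supnorm.
set S := supnorm v in vrho vgamma vs *.
have gvs j : gamma * `|v j| <= gamma * S by rewrite ler_pM2l.
have step j : `|z j - zbar| < rho ->
    `|z j.+1 - zbar| <= q * `|z j - zbar| + gamma * S.
  move=> zj; rewrite zE; apply: le_trans (lerD (lexx _) (gvs j)).
  apply: (Phi_le (z j, v j)); split; rewrite /= -ball_normE /= distrC//.
  by rewrite subr0; exact: le_lt_trans vrho.
have zk_lt j : `|z j - zbar| < rho.
  elim: j => // j IHj; apply: le_lt_trans (step _ IHj) _.
  have : q * `|z j - zbar| < q * rho by rewrite ltr_pM2l.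
  by move: vgamma; lra.
rewrite expRM_natl lnK ?posrE//.
elim: k => [|k IHk].
  rewrite expr0 mulr1 lerDl mulr_ge0//; first exact/ltW/divr_gt0.
  exact: le_trans (vs 0%N).
apply: (le_trans (step _ (zk_lt _))).
have : q * `|z k - zbar| <=
    q * (`|z 0%N - zbar| * q ^+ k + gamma / (1 - q) * S).
  by rewrite ler_pM2l.
have -> : q * (`|z 0%N - zbar| * q ^+ k + gamma / (1 - q) * S) =
  `|z 0%N - zbar| * q ^+ k.+1 + gamma / (1 - q) * S - gamma * S.
  by rewrite exprS; field; rewrite gt_eqF.
by lra.
Qed.

(** * The Newton-type iteration *)

Lemma uniformly_lipschitz_ball (R : realType) (X E P : normedModType R)
    (phi : X -> P -> E) (xbar : X) (ybar : P) (g : R) :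
  uniformly_lipschitz phi xbar ybar g ->
  exists2 rho : R, 0 < rho & forall x x' y,
    `|x - xbar| < rho -> `|x' - xbar| < rho -> `|y - ybar| < rho ->
    `|phi x y - phi x' y| <= g * `|x - x'|.
Proof.
move=> [A /nbhs_ballP[a /= a0 aA] /nbhs_ballP[b /= b0 bP]].
exists (Num.min a b) => [|x x' y]; first by rewrite lt_min a0.
rewrite !lt_min => /andP[xa _] /andP[x'a _] /andP[_ yb].
apply: (bP y _ (x, x')); first by rewrite -ball_normE /= distrC.
by split; apply: aA; rewrite -ball_normE /= distrC.
Qed.

Lemma add_setmap_perturbed (R : realType) (X Y : normedModType R)
    (g g' : X -> Y) (F : X -> set Y) (x : X) :
  add_setmap g' F x 0 <-> add_setmap g F x (- (g' x - g x)).
Proof.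
split=> -[y Fy gy]; exists y => //; last first.
  by rewrite -[g' x](subrK (g x)) -addrA gy subrr.
by rewrite opprB -[RHS]addr0 -gy addrA subrK.
Qed.

Section Newton.
Context {R : realType} {Z Z' V : normedModType R}.
Variables (f : Z -> V -> Z') (H : Z -> V -> {linear Z -> Z'}) (zbar : Z).

(** In [x], the perturbation is affine: the terms [f] and the base points of the
    linearization cancel in a difference, leaving [H z v - H zbar 0]. *)
Lemma fH_subE z v x x' :
  fH f H x z v - fH f H x zbar 0 - (fH f H x' z v - fH f H x' zbar 0) =
  (H z v \- H zbar 0) (x - x').
Proof.
have fHB p w : fH f H x p w - fH f H x' p w = H p w (x - x').
  by rewrite /fH opprD addrACA subrr add0r -linearB opprD addrACA subrr addr0.
rewrite /= -!fHB.
move: (fH f H x z v) (fH f H x' z v) (fH f H x zbar 0) (fH f H x' zbar 0).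
by move=> a b c d; rewrite opprD addrACA -opprD.
Qed.

(** The triangle inequality through [fH x zbar v]. The radius is independent of
    [x], because the Lipschitz conditions are uniform in the first argument of
    [fH]. *)
Lemma fH_perturbation_bound gamma_z gamma_v :
  uniformly_lipschitz (fun (zeta : Z) (p : Z * V) => fH f H p.1 zeta p.2)
    zbar (zbar, 0) gamma_z ->
  uniformly_lipschitz (fun (v : V) (p : Z * Z) => fH f H p.1 p.2 v)
    0 (zbar, zbar) gamma_v ->
  exists2 rho : R, 0 < rho & forall x z v,
    `|x - zbar| < rho -> `|z - zbar| < rho -> `|v| < rho ->
    `|fH f H x z v - fH f H x zbar 0| <= gamma_z * `|z - zbar| + gamma_v * `|v|.
Proof.
move=> /uniformly_lipschitz_ball[a a0 az] /uniformly_lipschitz_ball[b b0 bv].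
exists (Num.min a b) => [|x z v]; first by rewrite lt_min a0.
rewrite !lt_min => /andP[xa xb] /andP[za zb] /andP[va vb].
rewrite -(subrKA (fH f H x zbar v)) (le_trans (ler_normD _ _))// lerD//.
  apply: (az z zbar (x, v)) => //=; first by rewrite subrr normr0.
  by rewrite prod_normE /= subr0 gt_max xa.
rewrite -[v in gamma_v * `|v|]subr0; apply: (bv v 0 (x, zbar)) => /=.
- by rewrite subr0.
- by rewrite subrr normr0.
- by rewrite prod_normE /= subrr normr0 gt_max xb.
Qed.

End Newton.

(** The ball of radius [r] has to fit both in the neighborhood where the inverse
    of the linearized map is single-valued and in the one where the bound on the
    perturbation holds. Once [r] is chosen, all remaining smallness conditions
    bear on [eta p], hence hold for [p] close to [(zbar, 0)]. *)
Lemma newton_step_localized (R : realType) (Z : completeNormedModType R)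
    (Z' V : normedModType R) (f : Z -> V -> Z') (H : Z -> V -> {linear Z -> Z'})
    (F : Z -> set Z') (zbar : Z) (kappa gamma_z gamma_v : R) :
  0 < kappa -> 0 <= gamma_z -> 0 <= gamma_v ->
  uniformly_lipschitz (fun (zeta : Z) (p : Z * V) => fH f H p.1 zeta p.2)
    zbar (zbar, 0) gamma_z ->
  uniformly_lipschitz (fun (v : V) (p : Z * Z) => fH f H p.1 p.2 v)
    0 (zbar, zbar) gamma_v ->
  strongly_regular (add_setmap (fun z : Z => fH f H z zbar 0) F)
    zbar 0 kappa ->
  exists2 r : R, 0 < r &
    \forall p \near (zbar, 0 : V),
      exists2 z' : Z,
        next_iterates f H F p.1 p.2 `&` closed_ball zbar r = [set z'] &
        `|z' - zbar| <=
          kappa * (gamma_z * `|p.1 - zbar| + gamma_v * `|p.2|).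
Proof.
move=> k0 gz0 gv0 Lz Lv [G0 [U [W [s [nU nW slip sE]]]]].
have [rho rho0 fH_le] := fH_perturbation_bound Lz Lv.
have [u u0 uU] : exists2 u : R, 0 < u & forall x, `|x - zbar| < u -> U x.
  move/nbhs_ballP : nU => [u u0 uU]; exists u => // x xu.
  by apply: uU; rewrite -ball_normE /= distrC.
have [w w0 wW] : exists2 w : R, 0 < w & forall y, `|y| < w -> W y.
  move/nbhs_ballP : nW => [w w0 wW]; exists w => // y yw.
  by apply: wW; rewrite -ball_normE /= sub0r normrN.
(* Halving the minimum puts the closed ball of radius [r] inside both open
   balls. *)
pose r := Num.min rho u / 2.
have r0 : 0 < r by rewrite divr_gt0// lt_min rho0.
have [rrho ru] : r < rho /\ r < u.
  by apply/andP; rewrite -lt_min ltr_pdivrMr// ltr_pMr ?ltr1n// lt_min rho0.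
exists r => //.
pose eta (p : Z * V) := gamma_z * `|p.1 - zbar| + gamma_v * `|p.2|.
have eta_cvg : eta p @[p --> (zbar, 0 : V)] --> 0.
  rewrite (_ : 0 = gamma_z * `|zbar - zbar| + gamma_v * `|0 : V|); last first.
    by rewrite subrr !normr0 !mulr0 addr0.
  apply: cvgD; apply: cvgM; try exact: cvg_cst.
    by apply: cvg_norm; apply: cvgB; [exact: cvg_fst|exact: cvg_cst].
  by apply: cvg_norm; exact: cvg_snd.
have eta_small e : 0 < e -> \forall p \near (zbar, 0 : V), eta p < e.
  by move=> e0; apply: cvgr_lt eta_cvg _ e0.
near=> p.
have eta_ge0 : 0 <= eta p by rewrite addr_ge0// mulr_ge0.
have pz : `|p.1 - zbar| < rho.
  near: p; apply: (@cvgr_lt _ _ _ _ (fun p : Z * V => `|p.1 - zbar|) 0) => //.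
  rewrite -[X in _ --> X](normr0 Z) -(subrr zbar).
  by apply: cvg_norm; apply: cvgB; [exact: cvg_fst|exact: cvg_cst].
have pv : `|p.2| < rho.
  near: p; apply: (@cvgr_lt _ _ _ _ (fun p : Z * V => `|p.2|) 0) => //.
  by rewrite -[X in _ --> X](normr0 V); apply: cvg_norm; exact: cvg_snd.
pose h x := fH f H x p.1 p.2 - fH f H x zbar 0.
have h_eta x : `|x - zbar| <= r -> `|h x| <= eta p.
  by move=> xr; apply: fH_le => //; exact: le_lt_trans rrho.
have hlip : (eta p *+ 2 / r).-lipschitz_(closed_ball zbar r) h.
  (* [D y = h (zbar + y) - h zbar] is a difference of two values of [h] on the
     ball, hence the factor 2. *)
  have D_le y : `|y| <= r -> `|(H p.1 p.2 \- H zbar 0) y| <= eta p *+ 2.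
    move=> yr; rewrite -[y in X in `|X|](addrK zbar) -(fH_subE f).
    rewrite (le_trans (ler_normB _ _))// mulr2n lerD//.
      by apply: h_eta; rewrite addrK.
    by apply: h_eta; rewrite subrr normr0 ltW.
  move=> [x x'] _ /=; rewrite /h fH_subE.
  exact: linear_bound_from_ball D_le _.
have [|||||z' z'E z'le] := strong_regularity_perturbed (r := r) (eta := eta p)
  G0 slip sE (ltW k0) _ r0 _ _ h_eta hlip.
- by rewrite divr_ge0 ?mulrn_wge0// ltW.
- by move=> x xr; apply: uU; exact: le_lt_trans ru.
- by move=> y yr; apply: wW; apply: (le_lt_trans yr); near: p; exact: eta_small.
- rewrite mulrA ltr_pdivrMr// mul1r mulrC -ltr_pdivlMr//.
  rewrite -mulr_natr -ltr_pdivlMr//.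
  by near: p; apply: eta_small; apply: divr_gt0 => //; exact: divr_gt0.
- rewrite mulrC -ler_pdivlMr// ltW//; near: p.
  by apply: eta_small; rewrite divr_gt0.
exists z' => //; rewrite -z'E; congr (_ `&` _).
apply/funext => x; apply/propext.
exact: (add_setmap_perturbed (fun x => fH f H x zbar 0)
  (fun x => fH f H x p.1 p.2)).
Unshelve. all: by end_near.
Qed.

Theorem theorem2 (R : realType) (Z Z' V : completeNormedModType R)
    (f : Z -> V -> Z') (F : Z -> set Z') (H : Z -> V -> {linear Z -> Z'})
    (zbar : Z) (kappa gamma_z gamma_v : R) :
  0 < kappa -> 0 < gamma_z -> 0 < gamma_v ->
  add_setmap (f ^~ 0) F zbar 0 ->
  (exists L : R,
     uniformly_lipschitz (fun (z : Z) (p : Z * V) => fH f H z p.1 p.2)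
       zbar (zbar, 0) L) ->
  uniformly_lipschitz (fun (zeta : Z) (p : Z * V) => fH f H p.1 zeta p.2)
    zbar (zbar, 0) gamma_z ->
  uniformly_lipschitz (fun (v : V) (p : Z * Z) => fH f H p.1 p.2 v)
    0 (zbar, zbar) gamma_v ->
  strongly_regular (add_setmap (fun z : Z => fH f H z zbar 0) F)
    zbar 0 kappa ->
  kappa * gamma_z < 1 ->
  exists (U : set Z) (gamma : R),
    [/\ nbhs zbar U, 0 < gamma,
        \forall p \near (zbar, 0 : V),
          exists2 z' : Z,
            next_iterates f H F p.1 p.2 `&` U = [set z'] &
            `|z' - zbar| <=
              kappa * gamma_z * `|p.1 - zbar| + gamma * `|p.2| &
        forall Phi : Z -> V -> Z,
          (\forall p \near (zbar, 0 : V),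
             next_iterates f H F p.1 p.2 `&` U = [set Phi p.1 p.2]) ->
          locally_ISS Phi zbar].
Proof.
move=> k0 gz0 gv0 _ _ Lz Lv sreg kgz1.
have [r r0 step] := newton_step_localized k0 (ltW gz0) (ltW gv0) Lz Lv sreg.
have {}step : \forall p \near (zbar, 0 : V), exists2 z' : Z,
    next_iterates f H F p.1 p.2 `&` closed_ball zbar r = [set z'] &
    `|z' - zbar| <= kappa * gamma_z * `|p.1 - zbar| + kappa * gamma_v * `|p.2|.
  by apply: filterS step => p [z' z'E]; rewrite mulrDr !mulrA; exists z'.
exists (closed_ball zbar r), (kappa * gamma_v); split => //.
- by apply/nbhs_closedballP; exists (PosNum r0).
- exact: mulr_gt0.
move=> Phi PhiE; apply: (@locally_ISS_of_contraction _ _ _ _ _ (kappa * gamma_z)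
  (kappa * gamma_v)) => //; try exact: mulr_gt0.
apply: filterS2 step PhiE => p [z' -> z'_le] /seteqP[+ _] => /(_ z' erefl) z'E.
by rewrite -[Phi p.1 p.2]z'E.
Qed.
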